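(* Let $n,k\ge 1$ be integers and let $G_{2n+1}(k+1)$ be the simple graph with vertex set $$\{u_i, v_i : 1\le i\le 2k+1\}\cup\{y_{i,j}, z_{i,j} : 1\le i\le k,\ 1\le j\le 2n+1\}\cup\{x_{k+1,j} : 1\le j\le 2n+1\}$$ and edge set consisting of - $u_iv_i$ for $1\le i\le 2k+1$; - $u_iy_{i,j}$, $v_{2k+2-i}y_{i,j}$, $v_iz_{i,j}$, $u_{2k+2-i}z_{i,j}$ for $1\le i\le k$ and $1\le j\le 2n+1$; - $u_{k+1}x_{k+1,j}$, $v_{k+1}x_{k+1,j}$ for $1\le j\le 2n+1$. This graph has $k+1$ components, the $(k+1)$-st being a copy of $P_2\vee O_{2n+1}$. Then $\chi_{la}(G_{2n+1}(k+1))=3$.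
   Context: For a graph $G$ with $q$ edges, a local antimagic labeling is a bijection $f:E(G)\to\{1,2,\dots,q\}$ such that $f^+(u)\ne f^+(v)$ for every edge $uv\in E(G)$. Here $f^+(u)=\sum_{e\ni u} f(e)$ is the sum of the labels of the edges incident to $u$. The color number of $f$ is the number of distinct values of $f^+$. The local antimagic chromatic number $\chi_{la}(G)$ is the minimum color number over all local antimagic labelings of $G$. $P_2\vee O_m$ denotes the join of an edge with an edgeless graph on $m$ vertices. *)

(* Defs.v *)
From HB Require Import structures.
From mathcomp Require Import all_boot.

Set Implicit Arguments.
Unset Strict Implicit.
Unset Printing Implicit Defensive.

Record sgraph := SGraph {
  vertex :> finType;
  adj : rel vertex;
  adj_sym : symmetric adj;
  adj_irr : irreflexive adj }.

Section LocalAntimagic.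
Variable G : sgraph.

Definition edges : {set {set G}} :=
  [set [set p.1; p.2] | p : G * G & adj p.1 p.2].

(* Labelings are functions on all vertex sets, since edges are sets of two
   vertices; only their values on [edges] matter below. *)
Definition vertex_sum (f : {set G} -> nat) (u : G) : nat :=
  \sum_(e in edges | u \in e) f e.

Definition edge_bijection (f : {set G} -> nat) : Prop :=
  [/\ {in edges &, injective f},
      forall e, e \in edges -> 1 <= f e <= #|edges|
    & forall m, 1 <= m <= #|edges| -> exists2 e, e \in edges & f e = m].

Definition local_antimagic (f : {set G} -> nat) : Prop :=
  edge_bijection f /\
  forall u v : G, adj u v -> vertex_sum f u <> vertex_sum f v.

Definition color_number (f : {set G} -> nat) : nat :=
  size (undup [seq vertex_sum f u | u : G]).

(* A relation rather than a function, because some graphs (those with a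
   component K_2) have no local antimagic labeling; [c] is unique if it exists. *)
Definition is_chi_la (c : nat) : Prop :=
  (exists2 f, local_antimagic f & color_number f = c) /\
  (forall f, local_antimagic f -> c <= color_number f).

Definition component (x : G) : {set G} := [set y | connect (@adj G) x y].

Definition num_components : nat := n_comp (@adj G) G.

Section Induced.
Variable A : {set G}.

Definition induced_adj : rel {x : G | x \in A} :=
  fun x y => adj (val x) (val y).

Lemma induced_sym : symmetric induced_adj.
Proof. by move=> x y; exact: adj_sym. Qed.

Lemma induced_irr : irreflexive induced_adj.
Proof. by move=> x; exact: adj_irr. Qed.

Definition induced : sgraph := SGraph induced_sym induced_irr.
End Induced.

End LocalAntimagic.

Definition isomorphic (G H : sgraph) : Prop :=
  exists2 h : G -> H, bijective h & forall x y, adj (h x) (h y) = adj x y.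

Section Path.
Variable m : nat.

Definition path_adj : rel 'I_m :=
  fun i j => (i.+1 == j :> nat) || (j.+1 == i :> nat).

Lemma path_adj_sym : symmetric path_adj.
Proof. by move=> i j; exact: orbC. Qed.

Lemma path_adj_irr : irreflexive path_adj.
Proof. by move=> i; rewrite /path_adj orbb; apply/eqP/eqP; rewrite gtn_eqF. Qed.

Definition path_graph : sgraph := SGraph path_adj_sym path_adj_irr.

Definition edgeless_adj : rel 'I_m := fun _ _ => false.

Definition edgeless_graph : sgraph :=
  @SGraph 'I_m edgeless_adj (fun _ _ => erefl) (fun _ => erefl).
End Path.

Section Join.
Variables G H : sgraph.

Definition join_adj : rel (G + H)%type := fun x y =>
  match x, y with
  | inl a, inl b => adj a b
  | inr a, inr b => adj a b
  | _, _ => true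
  end.

Lemma join_adj_sym : symmetric join_adj.
Proof. by case=> a [] b //=; exact: adj_sym. Qed.

Lemma join_adj_irr : irreflexive join_adj.
Proof. by case=> a /=; exact: adj_irr. Qed.

Definition join_graph : sgraph := SGraph join_adj_sym join_adj_irr.
End Join.

(* All indices are shifted down by one: [Gu i] is u_{i+1}, [Gy i j] is
   y_{i+1,j+1}, [Gx j] is x_{k+1,j+1}, etc. *)
Inductive Gvertex (n k : nat) : Type :=
  | Gu of 'I_(2 * k).+1
  | Gv of 'I_(2 * k).+1
  | Gy of 'I_k & 'I_(2 * n).+1
  | Gz of 'I_k & 'I_(2 * n).+1
  | Gx of 'I_(2 * n).+1.

Section GraphG.
Variables n k : nat.

Definition Gvertex_code (x : Gvertex n k) :
    'I_(2 * k).+1 + 'I_(2 * k).+1 + ('I_k * 'I_(2 * n).+1)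
    + ('I_k * 'I_(2 * n).+1) + 'I_(2 * n).+1 :=
  match x with
  | Gu i => inl (inl (inl (inl i)))
  | Gv i => inl (inl (inl (inr i)))
  | Gy i j => inl (inl (inr (i, j)))
  | Gz i j => inl (inr (i, j))
  | Gx j => inr j
  end.

Definition Gvertex_decode c : Gvertex n k :=
  match c with
  | inl (inl (inl (inl i))) => Gu n i
  | inl (inl (inl (inr i))) => Gv n i
  | inl (inl (inr (i, j))) => Gy i j
  | inl (inr (i, j)) => Gz i j
  | inr j => Gx k j
  end.

Lemma Gvertex_codeK : cancel Gvertex_code Gvertex_decode.
Proof. by case. Qed.

HB.instance Definition _ := Finite.copy (Gvertex n k) (can_type Gvertex_codeK).

(* The index 2k+2-i becomes 2k-i after the shift. *)
Definition Garc (x y : Gvertex n k) : bool :=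
  match x, y with
  | Gu i, Gv i' => i == i'
  | Gu i, Gy a _ => i == a :> nat
  | Gv i, Gy a _ => i == 2 * k - a :> nat
  | Gv i, Gz a _ => i == a :> nat
  | Gu i, Gz a _ => i == 2 * k - a :> nat
  | Gu i, Gx _ => i == k :> nat
  | Gv i, Gx _ => i == k :> nat
  | _, _ => false
  end.

Definition Gadj : rel (Gvertex n k) := fun x y => Garc x y || Garc y x.

Lemma Gadj_sym : symmetric Gadj.
Proof. by move=> x y; exact: orbC. Qed.

Lemma Gadj_irr : irreflexive Gadj.
Proof. by case. Qed.

Definition graphG : sgraph := SGraph Gadj_sym Gadj_irr.

(* The vertex u_{k+1}. *)
Definition Gu_mid : graphG := Gu n (inord k).
End GraphG.

(* Main.v *)
(** With all indices starting at 0, put s = 2k+1 and m = 2n+1. The degree-2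
    vertices are w(i,j), i < s, j < m, with w(i,j) adjacent to u_i and
    v_(2k-i). Arrange the (2m+1)s edges in a table with 2m+1 rows and s
    columns: column i lists the edges from u_i to w(i,0), ..., w(i,m-1),
    then u_i v_i, then the edges from v_i to w(2k-i,m-1), ..., w(2k-i,0).
    Fill the table with 1, 2, ... row by row, alternately from right to left
    and from left to right. Two consecutive rows have constant column sums,
    and m + 1 is even, so the sum at u_i (rows 0..m) and the sum at v_i
    (rows m..2m) do not depend on i. The two edges at w(i,j) are centrally
    symmetric in the table, so their labels sum to s(2m+1) + 1. Three colors
    are necessary because the last component contains a triangle. *)
Require Import Defs.
From mathcomp Require Import all_boot zify.

Set Implicit Arguments.
Unset Strict Implicit.
Unset Printing Implicit Defensive.

(** * Boustrophedon filling of a table with [s] columns *)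

Section Snake.
Variable s : nat.

Definition snake (i r : nat) : nat := r * s + (if odd r then i.+1 else s - i).

(** Shifting labels to start at 0 gives a Euclidean division by [s]: the quotient is the row, and
    the remainder determines the column once the parity of the row is known. *)
Lemma snake_predE i r : i < s ->
  (snake i r).-1 = r * s + (if odd r then i else s.-1 - i).
Proof. rewrite /snake; case: (odd r) => ?; lia. Qed.

Lemma snake_inj i r i' r' : i < s -> i' < s ->
  snake i r = snake i' r' -> i = i' /\ r = r'.
Proof.
move=> lis li's /(congr1 predn); rewrite !snake_predE // => E.
have col_lt a b : a < s -> (if odd b then a else s.-1 - a) < s.
  by case: (odd b); lia.
have s0 : 0 < s by lia.
have rr : r = r'.
  by have := congr1 (divn^~ s) E; rewrite !divnMDl // !divn_small ?col_lt ?addn0.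
split=> //; move: E; rewrite rr => /addnI; case: (odd _); lia.
Qed.

Lemma snake_bounds i r q : i < s -> r < q -> 1 <= snake i r <= s * q.
Proof.
move=> lis lrq; have: r.+1 * s <= q * s by rewrite leq_mul2r lrq orbT.
rewrite mulSn [q * s]mulnC /snake; case: (odd _); lia.
Qed.

Lemma snake_surj x q : 1 <= x <= s * q ->
  exists i r, [/\ i < s, r < q & snake i r = x].
Proof.
case: x => // x /andP[_ lx]; have s0 : 0 < s by case: s lx.
have lts := ltn_pmod x s0; have E := divn_eq x s.
(* The remainder is read backwards on even rows, which run from right to left. *)
exists (if odd (x %/ s) then x %% s else s.-1 - x %% s), (x %/ s); split.
- by case: (odd _); lia.
- by rewrite ltn_divLR // mulnC.
rewrite /snake; case: (odd _); lia.
Qed.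

(** Rows r and r + 1 together contribute 2(r + 1)s + 1, whatever the column and the parity of r;
    this is summed over r = a, a + 2, ..., a + 2(t - 1). *)
Lemma sum_snake i a t : i < s ->
  \sum_(a <= r < a + 2 * t) snake i r = s * (2 * a * t + 2 * t ^ 2) + t.
Proof.
move=> lis; elim: t => [|t IH]; first by rewrite muln0 addn0 big_geq //; lia.
rewrite (_ : a + 2 * t.+1 = (a + 2 * t).+2); last by lia.
rewrite !big_nat_recr /= ?IH; [|lia|lia].
by rewrite /snake oddS; case: (odd _) => /=; nia.
Qed.

(** As [q] is odd, a row and its mirror image run in the same direction, so the offsets within the
    two rows add up to s + 1. *)
Lemma snake_rev i r q : i < s -> odd q -> r < q ->
  snake i r + snake (s.-1 - i) (q.-1 - r) = s * q + 1.
Proof.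
move=> lis oq lrq; rewrite /snake; have -> : odd (q.-1 - r) = odd r by lia.
have E : r * s + (q.-1 - r) * s + s = s * q.
  by rewrite -mulnDl -mulSnr mulnC; congr (_ * _); lia.
by case: (odd r); lia.
Qed.

End Snake.

(** * The graph described by three families of vertices u, v, w *)

Section Graph.
Variables n k : nat.
Let s := (2 * k).+1.
Let m := (2 * n).+1.
Local Notation V := (graphG n k).
Local Notation u i := (Gu n i : V).
Local Notation v i := (Gv n i : V).

(* [Gw i j] is y_(i,j) for i < k, x_j for i = k, and z_(2k-i,j) for i > k. *)
Definition Gw (i : 'I_s) (j : 'I_m) : V :=
  if insub (i : nat) is Some a then Gy a j
  else if insub (2 * k - i) is Some a then Gz a j else Gx k j.
Local Notation w := Gw.

(** Replaces the five constructors by three families: [Gy a j] is w(a,j), [Gz a j] is w(2k-a,j) and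
    [Gx k j] is w(k,j). *)
Lemma uvw_ind (P : V -> Prop) :
  (forall i, P (u i)) -> (forall i, P (v i)) -> (forall i j, P (w i j)) ->
  forall x, P x.
Proof.
move=> Pu Pv Pw [i|i|a j|a j|j] //.
- have la : a < s by have := ltn_ord a; rewrite /s; lia.
  by have := Pw (Ordinal la) j; rewrite /Gw /= valK.
- have lak := ltn_ord a; have la : 2 * k - a < s by rewrite /s; lia.
  have := Pw (Ordinal la) j; rewrite /Gw /= insubF; last by lia.
  rewrite (_ : 2 * k - (2 * k - a) = a) ?valK //; lia.
have la : k < s by rewrite /s; lia.
have := Pw (Ordinal la) j; rewrite /Gw /= insubF; last by lia.
by rewrite insubF //; lia.
Qed.

Lemma adj_uv i i' : adj (u i) (v i') = (i == i').
Proof. by rewrite /= /Gadj /= orbF. Qed.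

Lemma adj_uw i i' j : adj (u i) (w i' j) = (i == i').
Proof.
have li' : i' < (2 * k).+1 := ltn_ord i'.
rewrite -[i == i']/(i == i' :> nat) /= /Gadj /= /Gw.
case: insubP => [a _|] /= => [->|ki]; first by rewrite orbF.
by case: insubP => [a _|] /= => [->|ki']; rewrite orbF; congr eq_op; lia.
Qed.

Lemma adj_vw i i' j : adj (v i) (w i' j) = (i == rev_ord i').
Proof.
have li' : i' < (2 * k).+1 := ltn_ord i'.
rewrite -[i == rev_ord i']/(i == 2 * k - i' :> nat) /= /Gadj /= /Gw.
case: insubP => [a _|] /= => [->|ki]; first by rewrite orbF.
by case: insubP => [a _|] /= => [->|ki']; rewrite orbF; congr eq_op; lia.
Qed.

Lemma adj_ww i j i' j' : adj (w i j) (w i' j') = false.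
Proof. by rewrite /= /Gadj /= /Gw; do !case: insubP. Qed.

Lemma eq_uu i i' : (u i == u i') = (i == i').
Proof. by apply/eqP/eqP => [[]|->]. Qed.

Lemma eq_vv i i' : (v i == v i') = (i == i').
Proof. by apply/eqP/eqP => [[]|->]. Qed.

Lemma eq_uw i i' j : (u i == w i' j) = false.
Proof. by apply/negP => /eqP; rewrite /Gw; do !case: insubP. Qed.

Lemma eq_vw i i' j : (v i == w i' j) = false.
Proof. by apply/negP => /eqP; rewrite /Gw; do !case: insubP. Qed.

Lemma eq_ww i j i' j' : (w i j == w i' j') = (i == i') && (j == j').
Proof.
apply/eqP/andP => [E|[/eqP-> /eqP->] //].
(* The first index of a w vertex is that of its only neighbour among the u vertices. *)
have Ei : i = i' by apply/eqP; rewrite -(adj_uw _ _ j') -E adj_uw.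
move: E; rewrite Ei eqxx /Gw.
by case: insubP => [a _ _ [->]|_] //; case: insubP => [a _ _ [->]|_ [->]].
Qed.

Lemma eq_uv i i' : (u i == v i') = false.
Proof. by apply/negP => /eqP. Qed.

(** * Edges as cells of a table *)

Let q := (2 * m).+1.

(* [p = (i, r)] is the table cell in column [i] and row [r]. *)
Definition end1 (p : 'I_s * 'I_q) : V :=
  if p.2 <= m then u p.1 else w (rev_ord p.1) (inord (2 * m - p.2)).
Definition end2 (p : 'I_s * 'I_q) : V :=
  if p.2 < m then w p.1 (inord p.2) else v p.1.
Definition edge p : {set V} := [set end1 p; end2 p].

Definition vertexE :=
  (eq_uu, eq_vv, eq_uw, eq_vw, eq_ww, eq_uv, fun i j i' => eq_sym (w i j) (u i'),
   fun i j i' => eq_sym (w i j) (v i'), fun i i' => eq_sym (v i) (u i')).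

Lemma u_in_edge i p : (u i \in edge p) = (p.1 == i) && (p.2 <= m).
Proof.
rewrite !inE /end1 /end2; case: (leqP p.2 m); case: (ltnP p.2 m);
  by rewrite ?vertexE ?orbF ?andbT ?andbF // eq_sym.
Qed.

Lemma v_in_edge i p : (v i \in edge p) = (p.1 == i) && (m <= p.2).
Proof.
rewrite !inE /end1 /end2; case: (leqP p.2 m); case: (ltnP p.2 m) => ? ?;
  by rewrite ?vertexE ?orbF ?andbT ?andbF // eq_sym.
Qed.

(** The two cells are exchanged by the half turn of the table, as [snake_rev] requires. *)
Lemma w_in_edge i j p : (w i j \in edge p) =
  (p.1 == i) && (p.2 == j :> nat)
  || (p.1 == rev_ord i) && (p.2 == 2 * m - j :> nat).
Proof.
have lj : j < (2 * n).+1 := ltn_ord j; have li : i < (2 * k).+1 := ltn_ord i.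
case: p => [[i' li'] [r lr]]; rewrite !inE /end1 /end2 /=.
have ordE N (a b : 'I_N) : (a == b) = (nat_of_ord a == nat_of_ord b) by [].
case: (leqP r m) => lrm; case: (ltnP r m) => lmr; rewrite ?vertexE ?orbF !ordE /=.
- by rewrite inordK; lia.
- lia.
- lia.
by rewrite inordK; lia.
Qed.

(** Each edge contains the u or the v of its column, and which of them it contains compares the row
    with [m]. Off row [m], the w endpoint then gives the exact row. *)
Lemma edge_inj : injective edge.
Proof.
move=> p p' E.
have Hu : (p.2 <= m) = (p'.1 == p.1) && (p'.2 <= m).
  by rewrite -u_in_edge -E u_in_edge eqxx.
have Hv : (m <= p.2) = (p'.1 == p.1) && (m <= p'.2).
  by rewrite -v_in_edge -E v_in_edge eqxx.
have E1 : p'.1 = p.1 by apply/eqP; move: Hu Hv; case: (p'.1 == p.1) => //=; lia.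
rewrite E1 eqxx /= in Hu Hv.
have E2 : p'.2 = p.2 :> nat.
  have lp : p.2 < (2 * m).+1 := ltn_ord p.2.
  case: (ltngtP p.2 m) => pm; last by lia.
    have := w_in_edge p.1 (inord p.2) p.
    by rewrite E w_in_edge E1 inordK // !eqxx /=; lia.
  have := w_in_edge (rev_ord p.1) (inord (2 * m - p.2)) p.
  by rewrite E w_in_edge E1 rev_ordK inordK ?eqxx /=; lia.
by case: p p' E1 E2 {E Hu Hv} => i r [i' r'] /= -> /val_inj->.
Qed.

Lemma adj_ends p : adj (end1 p) (end2 p).
Proof.
rewrite /end1 /end2; case: (leqP p.2 m); case: (ltnP p.2 m) => ? ?; try lia.
- by rewrite adj_uw.
- by rewrite adj_uv.
by rewrite adj_sym adj_vw rev_ordK.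
Qed.

Lemma adj_edge x y : adj x y -> exists p, [set x; y] = edge p.
Proof.
have uv i : exists p, [set u i; v i] = edge p.
  exists (i, inord m); rewrite /edge /end1 /end2 /= inordK ?leqnn ?ltnn //.
  by rewrite /q; lia.
have uw i j : exists p, [set u i; w i j] = edge p.
  have lj := ltn_ord j; exists (i, inord j).
  rewrite /edge /end1 /end2 /= inordK; last by rewrite /q; lia.
  by rewrite ltn_ord ltnW // inord_val.
have vw i j : exists p, [set v (rev_ord i); w i j] = edge p.
  have lj := ltn_ord j; exists (rev_ord i, inord (2 * m - j)).
  rewrite /edge /end1 /end2 /= inordK; last by rewrite /q; lia.
  rewrite ifF; last by lia.
  rewrite ifF; last by lia.
  rewrite rev_ordK subKn; last by lia.
  by rewrite inord_val setUC.
elim/uvw_ind: x => [i|i|i j]; elim/uvw_ind: y => [i'|i'|i' j'] //.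
- by rewrite adj_uv => /eqP->.
- by rewrite adj_uw => /eqP->.
- by rewrite adj_sym adj_uv setUC => /eqP->.
- by rewrite adj_vw => /eqP->.
- by rewrite adj_sym adj_uw setUC => /eqP->.
- by rewrite adj_sym adj_vw setUC => /eqP->.
by rewrite adj_ww.
Qed.

Lemma edgesE : edges V = [set edge p | p in setT].
Proof.
apply/setP => e; apply/imsetP/imsetP => [[[x y]]|[p _ ->]].
  by rewrite inE /= => /adj_edge[p ->] ->; exists p.
by exists (end1 p, end2 p); rewrite ?inE ?adj_ends.
Qed.

Lemma card_edges : #|edges V| = s * q.
Proof.
by rewrite edgesE card_imset ?cardsT ?card_prod ?card_ord //; exact: edge_inj.
Qed.

(** * The labeling and its vertex sums *)

(** The sum plays the part of an inverse of [edge]: it has at most one term by [edge_inj], and its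
    value is 0 on sets that are not edges. *)
Definition labeling (e : {set V}) : nat :=
  \sum_(p | edge p == e) snake s p.1 p.2.

Lemma labeling_edge p : labeling (edge p) = snake s p.1 p.2.
Proof.
rewrite /labeling (eq_bigl (pred1 p)) ?big_pred1_eq // => p'.
by rewrite (inj_eq edge_inj).
Qed.

Lemma labeling_bijection : edge_bijection labeling.
Proof.
rewrite /edge_bijection card_edges edgesE; split.
- move=> _ _ /imsetP[p _ ->] /imsetP[p' _ ->]; rewrite !labeling_edge.
  case: p p' => i r [i' r'] /= E.
  by have [/val_inj-> /val_inj->] := snake_inj (ltn_ord i) (ltn_ord i') E.
- by move=> _ /imsetP[p _ ->]; rewrite labeling_edge snake_bounds.
move=> x /snake_surj[i [r [li lr <-]]].
exists (edge (Ordinal li, Ordinal lr)); first exact: imset_f.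
by rewrite labeling_edge.
Qed.

Lemma vertex_sumE x :
  vertex_sum labeling x = \sum_(p | x \in edge p) snake s p.1 p.2.
Proof.
rewrite /vertex_sum edgesE big_imset_cond /=; last by move=> ? ? _ _ /edge_inj.
by apply: eq_big => [p|p _]; rewrite ?inE ?labeling_edge.
Qed.

Lemma sum_u i : vertex_sum labeling (u i) = s * (2 * (n.+1) ^ 2) + n.+1.
Proof.
rewrite vertex_sumE (eq_bigl _ _ (u_in_edge i)).
rewrite -(pair_big (pred1 i) (fun r : 'I_q => r <= m) (fun i r => snake s i r)).
rewrite big_pred1_eq -(@big_ord_widen _ _ _ m.+1 q (snake s i)); last first.
  by rewrite /q; lia.
rewrite -(big_mkord xpredT (snake s i)).
(* Rows 0 to m form n + 1 consecutive pairs, since m + 1 = 2(n + 1). *)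
have := @sum_snake s i 0 n.+1 (ltn_ord i).
by rewrite (_ : 0 + 2 * n.+1 = m.+1) /m ?muln0 ?mul0n ?add0n //; lia.
Qed.

Lemma sum_v i :
  vertex_sum labeling (v i) = s * (2 * m * n.+1 + 2 * (n.+1) ^ 2) + n.+1.
Proof.
rewrite vertex_sumE (eq_bigl _ _ (v_in_edge i)).
rewrite -(pair_big (pred1 i) (fun r : 'I_q => m <= r) (fun i r => snake s i r)).
rewrite big_pred1_eq -(big_mkord (fun r => m <= r) (snake s i)).
rewrite -(@big_nat_widenl _ _ _ m 0 q xpredT) //.
(* Rows m to 2m form n + 1 pairs again, now starting from a = m. *)
by rewrite -(sum_snake _ _ (ltn_ord i)) (_ : m + 2 * n.+1 = q) // /q /m; lia.
Qed.

Lemma sum_w i j : vertex_sum labeling (w i j) = s * q + 1.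
Proof.
have lj := ltn_ord j.
have jq : j < q by rewrite /q; lia.
have jq' : 2 * m - j < q by rewrite /q; lia.
rewrite vertex_sumE (eq_bigl _ _ (w_in_edge i j)).
rewrite (bigD1 (i, Ordinal jq)) /= ?eqxx //.
(* The second cell differs from the first because j < m gives j < 2m - j. *)
rewrite (bigD1 (rev_ord i, Ordinal jq')) /=; last first.
  rewrite !eqxx orbT /= xpair_eqE -[Ordinal jq' == _]val_eqE /=.
  by apply/nandP; right; lia.
rewrite big1 => [|[i' r] /=]; last first.
  rewrite !xpair_eqE -!(val_eqE r) /= -andbA.
  by case/and3P=> /orP[]->; rewrite ?andbF.
rewrite addn0 /= -(@snake_rev s i j q) ?ltn_ord //.
by rewrite /q; lia.
Qed.

(** * Connected components *)

(** The index of the component, which merges the mirror columns i and 2k - i. *)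
Definition block (x : V) : nat :=
  match x with
  | Gu i | Gv i => minn i (2 * k - i)
  | Gy a _ | Gz a _ => a
  | Gx _ => k
  end.

Lemma block_le x : block x <= k.
Proof.
by case: x => [i|i|a _|a _|_] /=; rewrite ?(ltnW (ltn_ord a)) //; lia.
Qed.

Lemma adj_block (x y : V) : adj x y -> block x = block y.
Proof.
have arc (x' y' : Gvertex n k) : Garc x' y' -> block x' = block y'.
  case: x' => [i|i|a j|a j|j]; case: y' => [i'|i'|a' j'|a' j'|j'] //=;
    move=> /eqP->; rewrite ?minnn //; try (have := ltn_ord a'); lia.
by case/orP => /arc.
Qed.

Lemma connect_block (x y : V) : connect (@adj V) x y -> block x = block y.
Proof.
case/connectP => p; elim: p x => [|z p IH] x /=; first by move=> _ ->.
by case/andP => /adj_block-> /IH h /h.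
Qed.

Lemma connect_symG : connect_sym (@adj V).
Proof. exact/sym_connect_sym/adj_sym. Qed.

Lemma connect_u x : connect (@adj V) x (u (inord (block x))).
Proof.
(* The path is u_i, w(i,0), v_(2k-i), u_(2k-i). *)
have rev i : connect (@adj V) (u i) (u (rev_ord i)).
  apply: (@connect_trans _ _ (w i ord0)); first by rewrite connect1 ?adj_uw.
  apply: (@connect_trans _ _ (v (rev_ord i))); apply: connect1; rewrite adj_sym.
    by rewrite adj_vw.
  by rewrite adj_uv.
have [i xi] : exists i, connect (@adj V) x (u i).
  elim/uvw_ind: x => i; first by exists i.
    by exists i; rewrite connect1 // adj_sym adj_uv.
  by move=> j; exists i; rewrite connect1 // adj_sym adj_uw.
have li : i < (2 * k).+1 := ltn_ord i.
rewrite (connect_block xi) /=; case: (leqP i k) => ik.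
  by rewrite (_ : minn i _ = i) ?inord_val //; lia.
apply: connect_trans xi _; rewrite (_ : inord _ = rev_ord i) //.
by apply: val_inj; rewrite /= inordK /s; lia.
Qed.

Lemma connectE x y : connect (@adj V) x y = (block x == block y).
Proof.
apply/idP/eqP => [|E]; first exact: connect_block.
apply: connect_trans (connect_u x) _.
by rewrite connect_symG E connect_u.
Qed.

Lemma num_componentsE : num_components V = k.+1.
Proof.
have lt_s (t : 'I_k.+1) : t < s by have := ltn_ord t; rewrite /s; lia.
(* Components are counted by their roots, so [h] has to be a bijection from the block indices onto
   the roots. *)
pose h (t : 'I_k.+1) := root (@adj V) (u (Ordinal (lt_s t))).
have block_h t : block (u (Ordinal (lt_s t))) = t.
  by have := ltn_ord t; rewrite /=; lia.
have h_inj : injective h.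
  move=> t t' /(rootP connect_symG); rewrite connectE !block_h => /eqP.
  exact: val_inj.
rewrite /num_components /n_comp_mem -[RHS]card_ord -(card_codom h_inj).
apply: eq_card => x; rewrite !inE andbT; apply/eqP/codomP => [<-|[t ->]].
  have lx : block x < k.+1 by rewrite ltnS block_le.
  exists (Ordinal lx); apply/(rootP connect_symG).
  by rewrite connectE block_h.
by rewrite root_root //; exact: connect_symG.
Qed.

Lemma in_component_mid x : (x \in component (Gu_mid n k)) = (block x == k).
Proof.
rewrite inE connectE eq_sym /= inordK; last lia.
by congr (_ == _); lia.
Qed.

Lemma component_mid_iso :
  isomorphic (induced (component (Gu_mid n k)))
    (join_graph (path_graph 2) (edgeless_graph (2 * n).+1)).
Proof.
pose W := induced (component (Gu_mid n k)).
pose J := join_graph (path_graph 2) (edgeless_graph (2 * n).+1).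
(* The default branch is meant for u_k; the [Gy] and [Gz] vertices have block below [k], so none
   lies in this component. *)
pose h (x : W) : J := match val x with
  | Gx j => inr j | Gv _ => inl ord_max | _ => inl ord0 end.
pose g (z : J) : V := match z with
  | inl b => if b == ord0 then u (inord k) else v (inord k) | inr j => Gx k j end.
have gP z : g z \in component (Gu_mid n k).
  rewrite in_component_mid; case: z => [b|j] //=.
  by case: ifP => _ /=; rewrite inordK; lia.
have mid (i : 'I_s) : minn i (2 * k - i) == k -> i = inord k.
  have li : i < (2 * k).+1 := ltn_ord i.
  by move=> ik; apply: ord_inj; rewrite inordK; lia.
have k_mid : inord k = k :> nat := @inordK (2 * k) k ltac:(lia).
exists h.
  exists (fun z => exist _ (g z) (gP z)).
    case=> x xP; apply: val_inj => /=; move: xP; rewrite /h /= => xP.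
    have := xP; rewrite in_component_mid.
    by case: x {xP} => [i|i|a j|a j|j] //=; by [move/mid-> | rewrite ltn_eqF].
  case=> [b|j] //; rewrite /h /=; case: eqP => [->|nb] //=.
  congr inl; apply: val_inj; case: b nb => -[|[|b]] lb //= nb.
  by case: nb; apply: val_inj.
case=> x xP [y yP]; rewrite /h /= /induced_adj /=.
move: xP yP; rewrite !in_component_mid.
case: x => [i|i|a j|a j|j]; case: y => [i'|i'|a' j'|a' j'|j'] //=;
  rewrite ?(ltn_eqF (ltn_ord _)) //.
1,3: by move=> /mid-> /mid->; rewrite /Gadj /= eqxx.
all: by try move/mid->; try (move=> _ /mid->); rewrite /Gadj /= k_mid eqxx.
Qed.

(** * Exactly three colors *)

(** For n >= 1, q = 4n + 3 is at most 2(n + 1)^2, and 1 < n + 1 makes the inequality strict. *)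
Lemma sum_w_lt_u : 1 <= n -> s * q + 1 < s * (2 * (n.+1) ^ 2) + n.+1.
Proof.
move=> n_gt0; have : s * q <= s * (2 * (n.+1) ^ 2).
  by rewrite leq_mul2l /q /m; apply/orP; right; nia.
by lia.
Qed.

Lemma sum_u_lt_v : s * (2 * (n.+1) ^ 2) + n.+1 <
  s * (2 * m * n.+1 + 2 * (n.+1) ^ 2) + n.+1.
Proof. by rewrite ltn_add2r ltn_mul2l /s /m /=; lia. Qed.

Lemma labeling_local_antimagic : 1 <= n -> local_antimagic labeling.
Proof.
move=> n_gt0; have wu := sum_w_lt_u n_gt0; have uv := sum_u_lt_v.
split; first exact: labeling_bijection.
move=> x y; elim/uvw_ind: x => [i|i|i j]; elim/uvw_ind: y => [i'|i'|i' j'] //;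
  by rewrite ?adj_ww // ?sum_u ?sum_v ?sum_w; lia.
Qed.

Lemma color_number_labeling : 1 <= n -> color_number labeling = 3.
Proof.
move=> n_gt0; have wu := sum_w_lt_u n_gt0; have uv := sum_u_lt_v.
(* One representative per family suffices, as the sums are constant on each. *)
pose colors := [:: vertex_sum labeling (w ord0 ord0);
  vertex_sum labeling (u ord0); vertex_sum labeling (v ord0)].
have uniq_colors : uniq colors.
  by rewrite /= !inE sum_u sum_v sum_w; lia.
rewrite -[3]/(size colors); apply/perm_size/uniq_perm; rewrite ?undup_uniq //.
move=> x; rewrite mem_undup; apply/mapP/idP => [[y _ ->]|].
  rewrite !inE !sum_u !sum_v sum_w; elim/uvw_ind: y => *;
  by rewrite ?sum_u ?sum_v ?sum_w eqxx ?orbT.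
by rewrite !inE => /or3P[] /eqP->; eexists; rewrite ?mem_enum.
Qed.

End Graph.

(** * The lower bound and the conclusion *)

Lemma triangle_color_number (G : sgraph) (x y z : G) (f : {set G} -> nat) :
  adj x y -> adj x z -> adj y z -> local_antimagic f -> 3 <= color_number f.
Proof.
move=> xy xz yz [_ af].
apply: (@uniq_leq_size _ [:: vertex_sum f x; vertex_sum f y; vertex_sum f z]).
  by rewrite /= !inE negb_or; apply/and3P; split=> //;
    [apply/andP; split; apply/eqP/af | apply/eqP/af].
by move=> c; rewrite mem_undup !inE => /or3P[] /eqP->; rewrite map_f ?mem_enum.
Qed.

Theorem theorem3p1 (n k : nat) (hn : 1 <= n) (hk : 1 <= k) :
  [/\ num_components (graphG n k) = k.+1,
      isomorphic (induced (component (Gu_mid n k)))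
                 (join_graph (path_graph 2) (edgeless_graph (2 * n).+1))
    & is_chi_la (graphG n k) 3].
Proof.
split; [exact: num_componentsE | exact: component_mid_iso | split].
  exists (@labeling n k); first exact: labeling_local_antimagic.
  exact: color_number_labeling.
move=> f; have k_mid : inord k = k :> nat := @inordK (2 * k) k ltac:(lia).
(* The triangle lies in the middle component: the edge of column k and one of the vertices joined to
   it. *)
apply: (@triangle_color_number _ (Gu n (inord k) : graphG n k)
  (Gv n (inord k) : graphG n k) (Gx k ord0 : graphG n k)).
- by rewrite adj_uv.
- by rewrite /= /Gadj /= k_mid eqxx.
by rewrite /= /Gadj /= k_mid eqxx.
Qed.
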